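(* Let $K$ be a simplicial complex with at least one non-conelike vertex. Then the quaternionic moment-angle complex $Z_K^{\mathbb{H}}(D^4,S^3)$ is not aspherical.
   Context: Let $K$ be a simplicial complex on the vertex set $[m]=\{1,\dots,m\}$. A vertex $i$ of $K$ is called conelike if it is joined by an edge of $K$ to every other vertex of $K$; otherwise it is non-conelike. Let $D^4\subset\mathbb{H}$ be the unit $4$-disk in the quaternions and $S^3=\partial D^4$. The quaternionic moment-angle complex of $K$ is $$Z_K^{\mathbb{H}}(D^4,S^3)=Z_K(D^4,S^3)=\bigcup_{J\in K}\left(\prod_{i\in J} D^4\times\prod_{i\in[m]\setminus J} S^3\right)\subseteq (D^4)^m,$$ the union being over all simplices $J\subseteq[m]$ of $K$. *)

(* Defs.v *)
From HB Require Import structures.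
From mathcomp Require Import all_boot all_order all_algebra.
From mathcomp Require Import all_classical all_reals all_analysis.
Set Implicit Arguments.
Unset Strict Implicit.
Unset Printing Implicit Defensive.
Import Order.TTheory GRing.Theory Num.Theory.
Import numFieldNormedType.Exports.
Local Open Scope classical_set_scope.
Local Open Scope ring_scope.

Record simplicial_complex (m : nat) := SimplicialComplex {
  simplices :> {set {set 'I_m}};
  simplices_empty : finset.set0 \in simplices;
  simplices_vertex : forall i : 'I_m, [set i]%SET \in simplices;
  simplices_down : forall J J' : {set 'I_m},
    J' \subset J -> J \in simplices -> J' \in simplices }.

Definition conelike (m : nat) (K : simplicial_complex m) (i : 'I_m) : Prop :=
  forall j : 'I_m, j != i -> [set i; j]%SET \in simplices K.

(* The row (a, b, c, d) stands for the quaternion a + b i + c j + d k; only the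
   norm and the topology of the quaternions are used. *)
Definition quaternion (R : realType) : Type := 'rV[R]_4.

Definition qnorm (R : realType) (q : quaternion R) : R :=
  Num.sqrt (\sum_(k < 4) q ord0 k ^+ 2).

Definition disk4 (R : realType) : set (quaternion R) := [set q | qnorm q <= 1].

Definition sphere3 (R : realType) : set (quaternion R) := [set q | qnorm q = 1].

(* A point of H^m is a matrix whose i-th row is its i-th quaternion coordinate;
   the entrywise topology on matrices is the product topology. *)
Definition moment_angle_set (R : realType) (m : nat) (K : simplicial_complex m) :
    set 'M[R]_(m, 4) :=
  \bigcup_(J in [set J : {set 'I_m} | J \in simplices K])
    [set z : 'M[R]_(m, 4) | forall i : 'I_m,
      if i \in J then disk4 (row i z) else sphere3 (row i z)].

(* [set_type] carries the subspace topology. *)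
Definition moment_angle (R : realType) (m : nat) (K : simplicial_complex m) :
    topologicalType :=
  set_type (@moment_angle_set R m K).

Definition cube (R : realType) (n : nat) : set 'rV[R]_n :=
  [set s | forall i, 0 <= s ord0 i <= 1].

Definition cube_boundary (R : realType) (n : nat) : set 'rV[R]_n :=
  [set s | cube s /\ exists i, s ord0 i = 0 \/ s ord0 i = 1].

(* Maps (I^n, dI^n) -> (X, x). They are total functions on R^n of which only
   the restriction to the cube matters: [loop_homotopic] ignores the rest. *)
Definition nloop (R : realType) (n : nat) (X : topologicalType) (x : X) :
    set ('rV[R]_n -> X) :=
  [set f | {within @cube R n, continuous f} /\
           forall s, cube_boundary s -> f s = x].

Definition loop_homotopic (R : realType) (n : nat) (X : topologicalType)
    (x : X) (f g : 'rV[R]_n -> X) : Prop :=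
  exists H : R * 'rV[R]_n -> X,
    [/\ {within `[0, 1]%classic `*` @cube R n, continuous H},
        forall s, cube s -> H (0, s) = f s,
        forall s, cube s -> H (1, s) = g s &
        forall (t : R) s, 0 <= t <= 1 -> cube_boundary s -> H (t, s) = x].

(* The underlying set of pi_n(X, x): a homotopy class is the set of its
   representatives. *)
Definition homotopy_group (R : realType) (n : nat) (X : topologicalType)
    (x : X) : set (set ('rV[R]_n -> X)) :=
  [set C | exists2 f, nloop x f &
           C = [set g | nloop x g /\ loop_homotopic x f g]].

(* A group is trivial iff it has at most one element, so the group law is not
   needed. Connectedness is not part of the definition; hence "not aspherical"
   always means that some higher homotopy group is nontrivial. *)
Definition aspherical (R : realType) (X : topologicalType) : Prop :=
  forall (n : nat) (x : X), (2 <= n)%N -> is_subset1 (@homotopy_group R n X x).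

(* Main.v *)
Require Import Defs.
From mathcomp Require Import all_boot all_order all_algebra all_fingroup.
From mathcomp Require Import all_classical all_reals all_analysis.
From mathcomp Require Import zify ring lra.
Set Implicit Arguments.
Unset Strict Implicit.
Unset Printing Implicit Defensive.
Import Order.TTheory GRing.Theory Num.Theory.
Import numFieldNormedType.Exports.
Local Open Scope classical_set_scope.
Local Open Scope ring_scope.

(** If i is not conelike, there is j <> i with {i, j} not a simplex. Projecting Z_K
to its i-th and j-th coordinates gives a retraction of Z_K onto the complex of two
points D^4 x S^3 u S^3 x D^4, which is the boundary of D^4 x D^4, a 7-sphere. Hence
a degree one loop of this sphere would be null-homotopic if pi_7(Z_K) were trivial,
and the null-homotopy, a nowhere zero map on the 8-cube, contradicts Brouwer's
theorem.

Brouwer's theorem follows from its combinatorial form (Kuhn): for labels l_i in F_2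
on the vertices of a subdivided cube with l_i = 0 on x_i = 0 and l_i = 1 on x_i = N,
some cell carries both values of every l_i. Indeed the sum of the cochain
dl_1 u ... u dl_n over all simplices of the Freudenthal triangulation is 1: replacing
one l_k by the indicator of x_k > 0 changes it by the sum of the coboundary of
dl_1 u ... u l'_k u ... u dl_n, with l'_k zero on both faces normal to the k-th axis;
interior facets cancel in pairs and boundary facets contribute 0. For the indicators,
a single simplex contributes. *)

(** * Kuhn's lemma *)

Lemma addF2 (x : 'F_2) : x + x = 0.
Proof. by case: x => [[|[|]]] //= ?; apply/val_inj. Qed.

(** The value of dl_0 u ... u dl_(n-1) on the n-simplex with vertices p 0, ..., p n. *)
Definition cup (X : Type) n (l : nat -> X -> 'F_2) (p : nat -> X) : 'F_2 :=
  \prod_(i < n) (l i (p i) + l i (p i.+1)).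

Section Cup.
Variable X : Type.
Implicit Types (l : nat -> X -> 'F_2) (p : nat -> X).

Lemma cupS n l p : cup n.+1 l p =
  (l 0%N (p 0%N) + l 0%N (p 1%N)) * cup n (l \o S) (p \o S).
Proof. by rewrite /cup big_ord_recl. Qed.

Lemma eq_cup n l l' p p' :
  (forall i, (i < n)%N -> l i =1 l' i) -> (forall i, (i <= n)%N -> p i = p' i) ->
  cup n l p = cup n l' p'.
Proof.
move=> el ep; apply: eq_bigr => i _.
by rewrite !el // !ep // ltnW.
Qed.

(** A cup product of coboundaries is a cocycle; [p \o bump m] is the m-th facet. The first factors
    of facets 0 and 1 add up to the first factor common to all later facets, which leaves the claim
    for the tail of [p]. *)
Lemma sum_cup_facets n l p : \sum_(m < n.+2) cup n l (p \o bump m) = 0.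
Proof.
elim: n l p => [|n IH] l p.
  by rewrite !big_ord_recl big_ord0 /cup !big_ord0 addr0 addF2.
rewrite big_ord_recl [X in _ + X]big_ord_recl /=.
have e0 : cup n.+1 l (p \o bump 0) =
    (l 0%N (p 1%N) + l 0%N (p 2%N)) * cup n (l \o S) (p \o S \o bump 0).
  by rewrite cupS.
have e1 : cup n.+1 l (p \o bump 1) =
    (l 0%N (p 0%N) + l 0%N (p 2%N)) * cup n (l \o S) (p \o S \o bump 0).
  by rewrite cupS.
have e2 m : cup n.+1 l (p \o bump m.+2) =
    (l 0%N (p 0%N) + l 0%N (p 1%N)) * cup n (l \o S) (p \o S \o bump m.+1).
  by rewrite cupS; congr (_ * _); apply: eq_cup => // i _ /=; rewrite bumpS.
rewrite e0 e1; under eq_bigr => m _ do rewrite e2.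
rewrite -mulr_sumr addrA -mulrDl addrACA addF2 addr0 [X in X * _]addrC -mulrDr.
by have := IH (l \o S) (p \o S); rewrite big_ord_recl => ->; rewrite mulr0.
Qed.

(* The n-cochain l_0 u ... u l_k u ... u l_n where all but the k-th factor are
   replaced by their coboundaries. *)
Definition marked_cup k n l p : 'F_2 := l k (p k) * cup n (l \o bump k) p.

(** The Leibniz rule with dd = 0. For k = 0, facet 0 carries l_0 (p 1) and all others carry l_0 (p
    0), so closedness of the remaining product gives the factor dl_0. *)
Lemma sum_marked_cup_facets k n l p : (k <= n)%N ->
  \sum_(m < n.+2) marked_cup k n l (p \o bump m) = cup n.+1 l p.
Proof.
elim: k n l p => [|k IH] n l p.
  move=> _; have := sum_cup_facets n (l \o S) p.
  rewrite [in X in X -> _]big_ord_recl [in X in _ -> X]big_ord_recl cupS.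
  rewrite [X in _ -> _ + X = _](_ : _ = l 0%N (p 0%N) *
    \sum_(i < n.+1) cup n (l \o S) (p \o bump (lift ord0 i))); last first.
    by rewrite mulr_sumr.
  move=> /eqP; rewrite addr_eq0 => /eqP e.
  rewrite mulrDl addrC; congr (_ * _ + _ * _).
  rewrite -[LHS]opprK -e.
  by apply/eqP; rewrite eq_sym -addr_eq0 addF2.
case: n => [//|n]; rewrite ltnS => kn.
rewrite cupS -(IH n _ _ kn).
have mS l' p' : marked_cup k.+1 n.+1 l' p' =
    (l' 0%N (p' 0%N) + l' 0%N (p' 1%N)) * marked_cup k n (l' \o S) (p' \o S).
  rewrite /marked_cup cupS mulrCA; congr (_ * (_ * _)).
  by apply: eq_cup => // i _ x /=; rewrite bumpS.
have em l' p' p'' : p' =1 p'' -> marked_cup k n l' p' = marked_cup k n l' p''.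
  by move=> ep; rewrite /marked_cup ep; congr (_ * _); apply: eq_cup.
have e0 : marked_cup k.+1 n.+1 l (p \o bump 0) =
    (l 0%N (p 1%N) + l 0%N (p 2%N)) * marked_cup k n (l \o S) (p \o S \o bump 0).
  by rewrite mS.
have e1 : marked_cup k.+1 n.+1 l (p \o bump 1) =
    (l 0%N (p 0%N) + l 0%N (p 2%N)) * marked_cup k n (l \o S) (p \o S \o bump 0).
  by rewrite mS.
have e2 m : marked_cup k.+1 n.+1 l (p \o bump m.+2) =
    (l 0%N (p 0%N) + l 0%N (p 1%N)) * marked_cup k n (l \o S) (p \o S \o bump m.+1).
  by rewrite mS; congr (_ * _); apply: em => i /=; rewrite bumpS.
rewrite big_ord_recl [X in _ + X]big_ord_recl /= e0 e1.
under eq_bigr => m _ do rewrite e2.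
rewrite -mulr_sumr addrA -mulrDl addrACA addF2 addr0 [X in X * _]addrC -mulrDr.
by rewrite [in RHS]big_ord_recl.
Qed.

(** If l_j is constant on the simplex, the factor dl_j vanishes for j <> k; for j = k the factor l_k
    is not differentiated and must itself be 0. *)
Lemma marked_cup_eq0 k n l p j a : (j <= n)%N -> (k <= n)%N ->
  (j = k -> a = 0) -> (forall i, (i <= n)%N -> l j (p i) = a) ->
  marked_cup k n l p = 0.
Proof.
move=> jn kn ja la; rewrite /marked_cup.
have [jk|jk] := eqVneq j k; first by rewrite -jk la // (ja jk) mul0r.
have bj : bump k (unbump k j) = j by apply: unbumpK; rewrite inE.
have un : (unbump k j < n)%N.
  by rewrite /unbump; case: ltnP => kj /=; lia.
by rewrite /cup (bigD1 (Ordinal un)) //= bj !la ?addF2 ?mul0r ?mulr0 // ltnW.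
Qed.

Lemma eq_marked_cup k n l p p' : (k <= n)%N ->
  (forall i, (i <= n)%N -> p i = p' i) ->
  marked_cup k n l p = marked_cup k n l p'.
Proof. by move=> kn ep; rewrite /marked_cup ep //; congr (_ * _); apply: eq_cup. Qed.

End Cup.

(** * Summation over the Freudenthal triangulation *)

Section Kuhn.
Variables n N : nat.
Notation grid := {ffun 'I_n.+1 -> nat}.
Implicit Types (l : nat -> grid -> 'F_2) (q : {ffun 'I_n.+1 -> 'I_N.+1}).
Implicit Types (t : 'S_n.+1).

(* The vertices, for 0 <= i <= n.+1, of the simplex with parameter t in the
   Freudenthal triangulation of the unit cell whose least vertex is q. *)
Definition simplex_vertex q t (i : nat) : grid :=
  [ffun c => (q c + (t c < i))%N].

Definition cup_sum l : 'F_2 :=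
  \sum_(t : 'S_n.+1) \sum_q cup n.+1 l (simplex_vertex q t).

(** Multiplication by an odd permutation exchanges even and odd ones, so the two halves of the sum
    are equal. *)
Lemma sum_perm_F2 (g : 'S_n.+1 -> 'F_2) (s : 'S_n.+1) :
  odd_perm s -> (forall t, g (t * s)%g = g t) -> \sum_t g t = 0.
Proof.
move=> os gs; rewrite (bigID (@odd_perm _)) /=.
rewrite (reindex_inj (mulIg s)) /=.
rewrite (eq_bigl (fun t => ~~ odd_perm t)) => [|t]; last by rewrite odd_permM os addbT.
by rewrite (eq_bigr g) ?addF2.
Qed.

(** Dropping vertex m+1 forgets in which order the coordinates with [t]-values m and m+1 are
    increased, so two simplices of the same cell share this facet. *)
Lemma sum_inner_facets k l (m : 'I_n) : (k <= n)%N ->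
  \sum_(t : 'S_n.+1) \sum_q marked_cup k n l (simplex_vertex q t \o bump m.+1) = 0.
Proof.
move=> kn; pose a : 'I_n.+1 := widen_ord (leqnSn n) m; pose b := lift ord0 m.
have ab : a != b by rewrite -val_eqE /= neq_ltn ltnSn.
apply: (sum_perm_F2 (s := tperm a b)); first by rewrite odd_tperm.
move=> t; apply: eq_bigr => q _; apply: eq_marked_cup => // i _ /=.
apply/ffunP => c; rewrite !ffunE permM; congr (_ + _)%N; congr nat_of_bool.
case: tpermP => [->|->|//]; rewrite /= /bump; case: (ltnP m i) => /=; lia.
Qed.

Definition ord_pred_perm : 'S_n.+1 := perm (@ord_pred_inj n.+1).

(** The facet opposite vertex 0 is also the facet opposite the last vertex of a simplex in the next
    cell along c0, the axis that [t] increases first; in that simplex c0 is increased last. *)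
Lemma sum_outer_facets k l : (k <= n)%N ->
  (forall (c : 'I_n.+1) (x : grid), x c = 0%N -> l c x = 0) ->
  (forall (c : 'I_n.+1) (x : grid), x c = N.+1 -> l c x = (c != k :> nat)%:R) ->
  \sum_(t : 'S_n.+1) \sum_q marked_cup k n l (simplex_vertex q t \o bump 0) =
  \sum_(t : 'S_n.+1) \sum_q marked_cup k n l (simplex_vertex q t \o bump n.+1).
Proof.
move=> kn l0 l1; rewrite [RHS](reindex_inj (mulIg ord_pred_perm)) /=.
apply: eq_bigr => t _.
(* The wrap-around of [ordS] makes [sh] a bijection of the cells. *)
pose sh q : {ffun 'I_n.+1 -> 'I_N.+1} :=
  [ffun c => if t c == ord0 then ordS (q c) else q c].
have sh_inj : injective sh.
  move=> q q' /ffunP e; apply/ffunP => c; have := e c; rewrite !ffunE.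
  by case: ifP => // _ /ordS_inj.
rewrite [RHS](reindex_inj sh_inj); apply: eq_bigr => q _.
have [c0 tc0] : exists c0, t c0 = ord0 by exists ((t^-1)%g ord0); rewrite permKV.
(* Here the facet lies on x_c0 = N+1 and its wrapped partner on x_c0 = 0. Both contribute 0, as l_c0
   is constant on each, with value 0 if c0 = k. *)
have [qc0|qc0] := eqVneq (q c0) ord_max.
  rewrite (@marked_cup_eq0 _ _ _ _ _ c0 (c0 != k :> nat)%:R) //; first last.
  - by move=> i _; apply: l1; rewrite ffunE qc0 tc0 /= addn1.
  - by move=> ->; rewrite eqxx.
  - by rewrite -ltnS.
  rewrite (@marked_cup_eq0 _ _ _ _ _ c0 0) //; first by rewrite -ltnS.
  move=> i ni; apply: l0.
  rewrite !ffunE permM tc0 eqxx permE qc0 /= modnn /bump.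
  by rewrite modn_small // (ltnNge n i) ni /= ltnNge ni.
apply: eq_marked_cup => // i ni /=; apply/ffunP => c; rewrite !ffunE permM permE /=.
rewrite /bump [(n < i)%N]ltnNge ni /= add0n add1n ltnS.
have [tc|tc] := eqVneq (t c) ord0.
  have -> : c = c0 by apply: (@perm_inj _ t); rewrite tc.
  have qN : (q c0 < N)%N.
    rewrite ltn_neqAle -ltnS ltn_ord andbT.
    by apply: contraNneq qc0 => e; apply/eqP/val_inj.
  rewrite tc0 /= !modn_small ?ltnS // ltnNge ni /=; lia.
congr (_ + nat_of_bool _)%N.
have : t c != 0%N :> nat by [].
have := ltn_ord (t c); case: (nat_of_ord (t c)) => // a; rewrite ltnS => an _.
rewrite [X in (_ = (X %% _ < _))%N](_ : _ = a + n.+1)%N; last by rewrite /=; lia.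
by rewrite modnDr modn_small // ltnW.
Qed.

Lemma cup_sum_eq0 k l : (k <= n)%N ->
  (forall (c : 'I_n.+1) (x : grid), x c = 0%N -> l c x = 0) ->
  (forall (c : 'I_n.+1) (x : grid), x c = N.+1 -> l c x = (c != k :> nat)%:R) ->
  cup_sum l = 0.
Proof.
move=> kn l0 l1; rewrite /cup_sum.
under eq_bigr => t _ do under eq_bigr => q _ do
  rewrite -(sum_marked_cup_facets _ _ kn).
under eq_bigr => t _ do rewrite exchange_big.
rewrite exchange_big big_ord_recl big_ord_recr /=.
rewrite [X in _ + (X + _)]big1 => [|m _]; last exact: sum_inner_facets.
by rewrite add0r sum_outer_facets // addF2.
Qed.

Definition std_label (i : nat) (x : grid) : 'F_2 := (0 < x (inord i))%:R.

(** The i-th factor is nonzero only if q i = 0 and coordinate i is increased exactly between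
    vertices i and i+1, that is, t i = i. *)
Lemma cup_sum_std : cup_sum std_label = 1.
Proof.
have e q t : cup n.+1 std_label (simplex_vertex q t) =
    ((q == [ffun=> ord0]) && (t == 1%g))%:R.
  rewrite /cup; case: (boolP (_ && _)) => [/andP[/eqP-> /eqP->]|].
    rewrite big1 // => i _; rewrite /std_label !ffunE perm1 inord_val.
    by rewrite ltnn ltnSn /= add0r.
  move=> h; apply/eqP; apply: contraNT h => /prodf_neq0 nz.
  have H i : q i = ord0 /\ t i = i.
    have := nz i isT; rewrite /std_label !ffunE inord_val ltnS.
    case: (posnP (q i)) => [q0|qp].
      rewrite q0 !add0n !lt0b; case: (ltngtP (t i) i) => //.
      by move=> ti _; split; apply: val_inj.
    by rewrite !addn_gt0 qp addF2.
  by apply/andP; split; [apply/eqP/ffunP|apply/eqP/permP] => i;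
    rewrite ?ffunE ?perm1; case: (H i).
rewrite /cup_sum (bigD1 1%g) //= (bigD1 [ffun=> ord0]) //= e !eqxx.
rewrite big1 => [|q /negPf q0]; last by rewrite e q0.
rewrite big1 ?addr0 // => t /negPf t1; rewrite big1 // => q _.
by rewrite e t1 andbF.
Qed.

Lemma cup_sum_eq1 l :
  (forall (c : 'I_n.+1) (x : grid), x c = 0%N -> l c x = 0) ->
  (forall (c : 'I_n.+1) (x : grid), x c = N.+1 -> l c x = 1) ->
  cup_sum l = 1.
Proof.
(* The labels are exchanged one at a time: [h k] is standard below k. *)
move=> l0 l1; pose h k i x := if (i < k)%N then std_label i x else l i x.
have std0 (c : 'I_n.+1) (x : grid) : x c = 0%N -> std_label c x = 0.
  by rewrite /std_label inord_val => ->.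
have std1 (c : 'I_n.+1) (x : grid) : x c = N.+1 -> std_label c x = 1.
  by rewrite /std_label inord_val => ->.
have step k : (k <= n)%N -> cup_sum (h k) = cup_sum (h k.+1).
  move=> kn; apply/eqP; rewrite -subr_eq0.
  have -> z : - z = z :> 'F_2 by apply/eqP; rewrite eq_sym -addr_eq0 addF2.
  (* By linearity in the k-th label the difference is the sum for [g], whose k-th label vanishes on
     both faces normal to the k-th axis, as 1 + 1 = 0. *)
  pose g i x := if i == k then l k x + std_label k x else h k i x.
  rewrite -(@cup_sum_eq0 k g) //.
  - rewrite /cup_sum -big_split; apply/eqP; apply: eq_bigr => t _.
    rewrite -big_split; apply: eq_bigr => q _.
    pose K : 'I_n.+1 := Ordinal (kn : (k < n.+1)%N).
    have cupD l'' p : cup n.+1 l'' p = (l'' k (p k) + l'' k (p k.+1)) *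
        \prod_(i < n.+1 | i != K) (l'' i (p i) + l'' i (p i.+1)).
      by rewrite /cup (bigD1 K).
    have ek (i : 'I_n.+1) : i != K -> (i == k :> nat) = false by move/negPf.
    rewrite /= !cupD /g /h eqxx ltnn ltnSn.
    rewrite [in RHS](eq_bigr (fun i : 'I_n.+1 => h k i (simplex_vertex q t i) +
        h k i (simplex_vertex q t i.+1))) => [|i /ek ->]; last by [].
    rewrite [X in _ + _ * X](eq_bigr (fun i : 'I_n.+1 => h k i (simplex_vertex q t i) +
        h k i (simplex_vertex q t i.+1))) => [|i /ek ik].
      by rewrite /h -mulrDl addrACA.
    by rewrite /h ltnS leq_eqVlt ik.
  - move=> c x xc; rewrite /g /h; case: eqP => [<-|_]; first by rewrite l0 ?std0 ?addr0.
    by case: ifP => _; rewrite ?l0 ?std0.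
  - move=> c x xc; rewrite /g /h; case: eqP => [<-|_]; first by rewrite l1 ?std1 // addF2.
    by case: ifP => _; rewrite ?l1 ?std1.
have -> : cup_sum l = cup_sum (h 0%N) by [].
have {}step k : (k <= n.+1)%N -> cup_sum (h 0%N) = cup_sum (h k).
  by elim: k => // k IH kn; rewrite (IH (ltnW kn)); apply: step.
rewrite (step n.+1) // -cup_sum_std; apply: eq_bigr => t _; apply: eq_bigr => q _.
by apply: eq_cup => // i ni x; rewrite /h ni.
Qed.

(** Some simplex has a nonzero value, so none of its factors vanishes: l_c differs at its vertices c
    and c+1. *)
Theorem kuhn (l : 'I_n.+1 -> grid -> bool) :
  (forall c (x : grid), x c = 0%N -> l c x = false) ->
  (forall c (x : grid), x c = N.+1 -> l c x = true) ->
  exists q : {ffun 'I_n.+1 -> 'I_N.+1}, forall c, exists u v : grid,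
    [/\ forall i, (q i <= u i <= (q i).+1)%N, forall i, (q i <= v i <= (q i).+1)%N,
       l c u = false & l c v = true].
Proof.
move=> l0 l1; pose l' i x : 'F_2 := (l (inord i) x)%:R.
have : cup_sum l' != 0.
  by rewrite cup_sum_eq1 // => c x xc; rewrite /l' inord_val; [rewrite l0|rewrite l1].
case: (boolP [exists t : 'S_n.+1, exists q,
         cup n.+1 l' (simplex_vertex q t) != 0]); last first.
  rewrite negb_exists => /forallP h; suff -> : cup_sum l' = 0 by rewrite eqxx.
  apply: big1 => t _; apply: big1 => q _.
  by have := h t; rewrite negb_exists => /forallP /(_ q); rewrite negbK => /eqP.
case/existsP => t /existsP [q /prodf_neq0 nz] _; exists q => c.
have box i c' : (q c' <= simplex_vertex q t i c' <= (q c').+1)%N.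
  by rewrite ffunE; case: (_ < i)%N => /=; lia.
have := nz c isT; rewrite /l' inord_val.
have [] := (boolP (l c (simplex_vertex q t c)), boolP (l c (simplex_vertex q t c.+1))).
case=> h1; case=> h2; rewrite ?addF2 // => _.
- exists (simplex_vertex q t c.+1), (simplex_vertex q t c).
  by split=> //; apply/negbTE.
- exists (simplex_vertex q t c), (simplex_vertex q t c.+1).
  by split=> //; apply/negbTE.
Qed.

End Kuhn.

(** * Brouwer's theorem on the cube *)

Lemma le_mx_norm (R : realType) m n (x : 'M[R]_(m, n)) i j : `|x i j| <= `|x|.
Proof.
rewrite [leRHS]mx_normrE; exact: (@le_bigmax _ _ _ _ (fun ij => `|x ij.1 ij.2|) (i, j)).
Qed.

Lemma mx_norm_le (R : realType) m n (x : 'M[R]_(m, n)) e :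
  0 <= e -> (forall i j, `|x i j| <= e) -> `|x| <= e.
Proof. by move=> e0 xe; rewrite [leLHS]mx_normrE; apply: bigmax_le. Qed.

Lemma cube_compact (R : realType) n : compact (@cube R n).
Proof.
have := @rV_compact R n (fun=> `[0, 1]%classic) (fun=> @segment_compact R 0 1).
by congr compact; apply/funext => s; apply/propext;
  split => h i; have := h i; rewrite /= in_itv.
Qed.

Lemma kuhn_approx (R : realType) n (F : 'rV[R]_n.+1 -> 'rV[R]_n.+1) (N : nat) :
  (forall s, cube s -> cube (F s)) ->
  exists2 x, cube x & forall c, exists u v,
    [/\ cube u /\ cube v, `|u - x| <= N.+1%:R^-1, `|v - x| <= N.+1%:R^-1,
        u ord0 c <= F u ord0 c & F v ord0 c <= v ord0 c].
Proof.
move=> Fc.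
pose pt (x : {ffun 'I_n.+1 -> nat}) : 'rV[R]_n.+1 := \row_c ((x c)%:R / N.+1%:R).
(* The label is true where F lowers the c-th coordinate. The values forced on x_c = 0 and x_c = N+1
   are compatible with the weak inequalities because F preserves the cube. *)
pose l c (x : {ffun 'I_n.+1 -> nat}) :=
  if x c == 0%N then false else (N < x c)%N || (F (pt x) ord0 c < pt x ord0 c).
have [|c x xc|q kq] := @kuhn n N l.
- by move=> c x; rewrite /l => ->.
- by rewrite /l xc ltnSn.
have ptc (x : {ffun 'I_n.+1 -> nat}) :
    (forall i, (q i <= x i <= (q i).+1)%N) -> cube (pt x).
  move=> qx i; rewrite mxE divr_ge0 ?ler0n // ler_pdivrMr ?ltr0n // mul1r ler_nat /=.
  by have := qx i; have := ltn_ord (q i); lia.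
pose qn := [ffun i => nat_of_ord (q i)].
exists (pt qn); first by apply: ptc => i; rewrite ffunE leqnn leqnSn.
have near (x : {ffun 'I_n.+1 -> nat}) : (forall i, (q i <= x i <= (q i).+1)%N) ->
    `|pt x - pt qn| <= N.+1%:R^-1.
  move=> qx; apply: mx_norm_le; first by rewrite invr_ge0.
  move=> i j; rewrite !mxE ffunE -mulrBl.
  rewrite -natrB; last by case/andP: (qx j).
  rewrite normrM normr_nat ger0_norm ?invr_ge0 ?ler0n // ler_piMl ?invr_ge0 ?ler0n //.
  by rewrite -[1]/(1%:R) ler_nat; have := qx j; lia.
have Nn0 : N.+1%:R != 0 :> R by rewrite pnatr_eq0.
move=> c; have [u [v [qu qv]]] := kq c.
rewrite /l => lu lv; exists (pt u), (pt v).
split; [split| | | |]; try exact: ptc; try exact: near.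
- move: lu; case: eqP => [uc _|_ /negbT]; last by rewrite negb_or -leNgt => /andP[].
  by have /andP[] := Fc _ (ptc _ qu) c; rewrite [X in _ -> _ -> X <= _]mxE uc mul0r.
- move: lv; case: eqP => // _ /orP[Nv|/ltW //].
  have /andP[_ h] := Fc _ (ptc _ qv) c; apply: le_trans h _.
  rewrite mxE; have -> : v c = N.+1 by have := qv c; have := ltn_ord (q c); lia.
  by rewrite divff.
Qed.

(** A cluster point of the approximate fixed points is fixed: otherwise some coordinate of F w - w
    keeps a strict sign near it, while [u] and [v] show both weak signs arbitrarily close. *)
Theorem brouwer (R : realType) n (F : 'rV[R]_n.+1 -> 'rV[R]_n.+1) :
  {within @cube R n.+1, continuous F} -> (forall s, cube s -> cube (F s)) ->
  exists2 s, cube s & F s = s.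
Proof.
move=> /subspace_continuousP Fcont Fcube.
have /choice[x xP] (N : nat) : exists x, cube x /\ forall c, exists u v,
    [/\ cube u /\ cube v, `|u - x| <= N.+1%:R^-1, `|v - x| <= N.+1%:R^-1,
        u ord0 c <= F u ord0 c & F v ord0 c <= v ord0 c].
  by have [y ? ?] := kuhn_approx N Fcube; exists y.
have /(_ (x @ \oo) _)[|s [scube scl]] := @cube_compact R n.+1.
  by exists 0%N => // N _; case: (xP N).
exists s => //; apply/rowP => c; apply/eqP; rewrite -subr_eq0; apply/negP => /negP Fs0.
pose g w : R := F w ord0 c - w ord0 c.
have gcont : g @ within (@cube R n.+1) (nbhs s) --> g s.
  apply: cvgB; last by apply: cvg_within_filter; exact: coord_continuous.
  apply: (@continuous_cvg _ _ _ _ _ F (fun w : 'rV_n.+1 => w ord0 c)).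
    exact: coord_continuous.
  exact: Fcont.
(* The factor g s treats both signs of g s at once. *)
have : \forall w \near within (@cube R n.+1) (nbhs s), 0 < g w * g s.
  have gs2 : 0 < g s * g s by rewrite -expr2 exprn_even_gt0.
  have : (fun w => g w * g s) @ within (@cube R n.+1) (nbhs s) --> g s * g s.
    by apply: cvgMl.
  by move=> /(_ _ (lt_nbhsr gs2)).
move=> /nbhs_ballP [e /= e0 he].
(* One half of [e] bounds the step from s to x N, the other the step from x N to u and v. *)
have e20 : 0 < e / 2 by rewrite divr_gt0.
have [N0 hN0] : exists N0 : nat, forall N, (N0 <= N)%N -> (N.+1%:R^-1 : R) < e / 2.
  by have [N0 _ h] := near_infty_natSinv_lt (PosNum e20); exists N0 => N /h.
have [_ [[N hN <-] sxN]] := scl (x @` [set N | (N0 <= N)%N]) (ball s (e / 2))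
  (ex_intro2 _ _ N0 I (fun N h => ex_intro2 _ _ N h erefl)) (nbhsx_ballx _ _ e20).
have near w : `|w - x N| <= N.+1%:R^-1 -> ball s e w.
  move=> wx; rewrite [e]splitr; apply: ball_triangle sxN _.
  rewrite -ball_normE /= distrC; apply: le_lt_trans wx _; exact: hN0.
have [_ /(_ c) [u [v [[uc vc] /near us /near vs gu gv]]]] := xP N.
have gu0 : 0 <= g u by rewrite subr_ge0.
have gv0 : g v <= 0 by rewrite subr_le0.
have [gs|gs|gs] := ltrgtP 0 (g s); last by move: Fs0; rewrite -/(g s) -gs eqxx.
  by have := he _ vs vc; rewrite pmulr_lgt0 // ltNge gv0.
by have := he _ us uc; rewrite nmulr_lgt0 // ltNge gu0.
Qed.

Lemma mx_norm_attained (R : realType) m n (x : 'M[R]_(m, n)) :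
  x != 0 -> exists i j, `|x| = `|x i j|.
Proof.
rewrite -normr_eq0 => /mx_norm_neq0[[i j] /= e].
by exists i, j; exact: e.
Qed.

Lemma cvg_mx (R : realType) m n (T : Type) (F : set_system T) (f : T -> 'M[R]_(m, n))
    (M : 'M[R]_(m, n)) : Filter F ->
  (forall i j, f x i j @[x --> F] --> M i j) -> f @ F --> M.
Proof.
move=> FF fM A [P MP PA] /=.
suff : \forall x \near F, forall i j, P i j (f x i j).
  by apply: filterS => x Px; apply: PA.
apply: filter_forall => i; apply: filter_forall => j; exact: fM (MP i j).
Qed.

Lemma cvg_coord (R : realType) m n (T : Type) (F : set_system T) (f : T -> 'M[R]_(m, n))
    (M : 'M[R]_(m, n)) i j : Filter F ->
  f @ F --> M -> f x i j @[x --> F] --> M i j.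
Proof.
move=> FF fM; apply: (@continuous_cvg _ _ _ _ _ f (fun x : 'M[R]_(m, n) => x i j)) => //.
exact: coord_continuous.
Qed.

(* Brouwer's theorem for the map s |-> (1 - G s / |G s|) / 2 from the cube to
   its boundary. *)
Lemma poincare_bohl (R : realType) n (G : 'rV[R]_n.+1 -> 'rV[R]_n.+1) :
  {within @cube R n.+1, continuous G} -> (forall s, cube s -> G s != 0) ->
  exists s a, [/\ cube_boundary s, 0 < a & forall k, G s ord0 k = a * (1 - 2 * s ord0 k)].
Proof.
move=> /subspace_continuousP Gcont Gn0.
pose F s : 'rV[R]_n.+1 := \row_k ((1 - `|G s|^-1 * G s ord0 k) / 2).
have [||s cs Fs] := @brouwer R n F.
- apply/subspace_continuousP => s cs; apply: cvg_mx => i k; rewrite mxE.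
  under eq_cvg do rewrite mxE.
  apply: cvgMl; apply: cvgB; first exact: cvg_cst.
  apply: cvgM; last by apply: cvg_coord; exact: Gcont.
  apply: cvgV; first by rewrite normr_eq0 Gn0.
  by apply: cvg_norm; exact: Gcont.
- move=> s cs k; rewrite mxE.
  have G0 : 0 < `|G s| by rewrite normr_gt0 Gn0.
  have := le_mx_norm (G s) ord0 k; rewrite -(ler_pM2l (x := `|G s|^-1)) ?invr_gt0 //.
  rewrite mulVf ?gt_eqF // -[X in X * `|_|]ger0_norm ?invr_ge0 // -normrM ler_norml.
  lra.
have G0 : 0 < `|G s| by rewrite normr_gt0 Gn0.
have Gs k : G s ord0 k = `|G s| * (1 - 2 * s ord0 k).
  have := congr1 (fun v : 'rV[R]_n.+1 => v ord0 k) Fs; rewrite mxE => <-.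
  field; exact: lt0r_neq0.
exists s, `|G s|; split => //; split => //.
(* A coordinate attaining |G s| satisfies |1 - 2 s_k| = 1, which puts s on the boundary. *)
have [i [k Gk]] := mx_norm_attained (Gn0 _ cs).
exists k; have /andP[s0 s1] := cs k.
move: Gk; rewrite (ord1 i) Gs normrM normr_id.
move=> /eqP; rewrite -{1}[`|G s|]mulr1 (inj_eq (mulfI (lt0r_neq0 G0))) => /eqP.
case: (lerP 0 (1 - 2 * s ord0 k)) => h; rewrite ?(ger0_norm h) ?(ltr0_norm h).
  by left; lra.
by right; lra.
Qed.

(** * The 7-sphere in the moment-angle complex *)

Section Quaternion.
Variable R : realType.
Implicit Types q : quaternion R.

Lemma qnormZ a q : qnorm (a *: q : quaternion R) = `|a| * qnorm q.
Proof.
rewrite /qnorm -sqrtr_sqr -sqrtrM ?sqr_ge0 // mulr_sumr.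
by congr Num.sqrt; apply: eq_bigr => k _; rewrite mxE exprMn.
Qed.

Lemma qnorm_eq0 q : qnorm q = 0 -> q = 0.
Proof.
move=> /eqP; rewrite sqrtr_eq0 => h; apply/rowP => k; rewrite mxE.
have : \sum_(k < 4) q ord0 k ^+ 2 == 0.
  by rewrite eq_le h /= sumr_ge0 // => i _; exact: sqr_ge0.
rewrite psumr_eq0 => [/allP /(_ k)|i _]; last exact: sqr_ge0.
by rewrite mem_index_enum sqrf_eq0 => /(_ isT) /eqP.
Qed.

Lemma qnorm_ge0 q : 0 <= qnorm q. Proof. exact: sqrtr_ge0. Qed.

Lemma cvg_qnorm (T : Type) (F : set_system T) (f : T -> 'rV[R]_4) (q : 'rV[R]_4) :
  Filter F -> f @ F --> q -> @qnorm R (f x) @[x --> F] --> @qnorm R q.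
Proof.
move=> FF fq.
apply: (@continuous_cvg _ _ _ _ _ (fun x => \sum_(k < 4) f x ord0 k ^+ 2) Num.sqrt).
  exact: sqrt_continuous.
apply: cvg_big => [|k _]; first exact: add_continuous.
apply: (@continuous_cvg _ _ _ _ _ (fun x => f x ord0 k) (fun x => x ^+ 2)).
  exact: exprn_continuous.
exact: cvg_coord.
Qed.

(* The gauge of D^4 x D^4, whose boundary D^4 x S^3 u S^3 x D^4 is the
   moment-angle complex of two points. *)
Definition gauge (v : 'rV[R]_(4 + 4)) : R :=
  Num.max (qnorm (lsubmx v)) (qnorm (rsubmx v)).

Lemma gauge_gt0 v : v != 0 -> 0 < gauge v.
Proof.
move=> v0; rewrite lt_neqAle le_max qnorm_ge0 andbT eq_sym; apply/eqP => g0.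
have : qnorm (lsubmx v) <= 0 by rewrite -g0 /gauge le_max lexx.
have : qnorm (rsubmx v) <= 0 by rewrite -g0 /gauge le_max lexx orbT.
rewrite !le_eqVlt !(ltNge _ 0) !qnorm_ge0 !orbF => /eqP/qnorm_eq0 r0 /eqP/qnorm_eq0 l0.
by move/eqP: v0; apply; rewrite -[v]hsubmxK l0 r0 row_mx0.
Qed.

Lemma gaugeZ a v : 0 <= a -> gauge (a *: v) = a * gauge v.
Proof.
move=> a0; rewrite /gauge !linearZ /=; rewrite !qnormZ ger0_norm //.
by rewrite maxr_pMr.
Qed.

Lemma cvg_gauge (T : Type) (F : set_system T) (f : T -> 'rV[R]_(4 + 4))
    (v : 'rV[R]_(4 + 4)) :
  Filter F -> f @ F --> v -> gauge (f x) @[x --> F] --> gauge v.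
Proof.
move=> FF fv.
apply: (@continuous2_cvg _ _ _ _ _ _ (fun x => qnorm (lsubmx (f x)))
          (fun x => qnorm (rsubmx (f x))) Num.max).
- exact: (@max_continuous _ R (_, _)).
- apply: cvg_qnorm; apply: cvg_mx => i k; rewrite mxE.
  by under eq_cvg do rewrite mxE; exact: cvg_coord.
- apply: cvg_qnorm; apply: cvg_mx => i k; rewrite mxE.
  by under eq_cvg do rewrite mxE; exact: cvg_coord.
Qed.

End Quaternion.

(** * An essential loop in the 7-sphere *)

Section SphereLoop.
Variable R : realType.
Implicit Types s : 'rV[R]_7.

Definition center s : 'rV[R]_7 := \row_k (2 * s ord0 k - 1).

(* With y in [-1, 1]^7 and r = |y|, the map y |-> (2 r - 1, (1 - r) y) misses 0
   and sends the boundary r = 1 to (1, 0): up to rescaling, it is the collapse of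
   the 7-cube onto the 7-sphere. *)
Definition collapse s : 'rV[R]_(4 + 4) :=
  (row_mx (2 * `|center s| - 1)%:M ((1 - `|center s|) *: center s) : 'rV[R]_(1 + 7)).

Lemma collapse0 s : collapse s ord0 (lshift 7 ord0 : 'I_(1 + 7)) = 2 * `|center s| - 1.
Proof. by rewrite /collapse (@row_mxEl _ 1 1 7) mxE. Qed.

Lemma collapseS s (k : 'I_7) : collapse s ord0 (rshift 1 k : 'I_(1 + 7)) =
  (1 - `|center s|) * center s ord0 k.
Proof. by rewrite /collapse (@row_mxEr _ 1 1 7) mxE. Qed.

(** The first coordinate vanishes only for |y| = 1/2, where the others form y / 2. *)
Lemma collapse_neq0 s : collapse s != 0.
Proof.
apply/eqP => c0; have := collapse0 s; rewrite c0 mxE => h.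
have n0 : center s != 0 by rewrite -normr_eq0; apply/eqP => e; move: h; rewrite e; lra.
have [i [k]] := mx_norm_attained n0; rewrite (ord1 i) => e.
have := collapseS s k; rewrite c0 mxE => /esym/eqP; rewrite mulf_eq0.
rewrite -[X in _ || X]normr_eq0 -e => /orP[] /eqP; lra.
Qed.

Lemma norm_center_cube s : cube s -> `|center s| <= 1.
Proof.
move=> cs; apply: mx_norm_le => // i k; rewrite mxE ler_norml.
by have := cs k; lra.
Qed.

Lemma norm_center_boundary s : cube_boundary s -> `|center s| = 1.
Proof.
move=> [cs [k sk]]; apply/eqP; rewrite eq_le norm_center_cube //=.
apply: le_trans (le_mx_norm _ ord0 k); rewrite mxE.
by case: sk => ->; rewrite ?mulr0 ?sub0r ?normrN ?normr1 // mulr1 ger0_norm; lra.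
Qed.

Lemma cvg_collapse (T : Type) (F : set_system T) (f : T -> 'rV[R]_7) s :
  Filter F -> f @ F --> s -> collapse (f x) @[x --> F] --> collapse s.
Proof.
move=> FF fs.
have cc : center (f x) @[x --> F] --> center s.
  apply: cvg_mx => i k; rewrite mxE; under eq_cvg do rewrite mxE.
  by apply: cvgB; [apply: cvgMr; exact: cvg_coord|exact: cvg_cst].
have cn : `|center (f x)| @[x --> F] --> `|center s| by apply: cvg_norm.
apply: cvg_mx => i k; rewrite (ord1 i).
case: (split_ordP (k : 'I_(1 + 7))) => l ->.
  rewrite (ord1 l) collapse0; under eq_cvg do rewrite collapse0.
  by apply: cvgB; [apply: cvgMr|exact: cvg_cst].
rewrite collapseS; under eq_cvg do rewrite collapseS.
by apply: cvgM; [apply: cvgB => //; exact: cvg_cst|exact: cvg_coord].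
Qed.

(** The radial projection of [collapse] to the boundary of D^4 x D^4. *)
Definition sphere_loop s : 'rV[R]_(4 + 4) := (gauge (collapse s))^-1 *: collapse s.

Lemma gauge_sphere_loop s : gauge (sphere_loop s) = 1.
Proof.
have g0 := gauge_gt0 (collapse_neq0 s).
by rewrite gaugeZ ?invr_ge0 ?ltW // mulVf // gt_eqF.
Qed.

Lemma cvg_sphere_loop (T : Type) (F : set_system T) (f : T -> 'rV[R]_7) s :
  Filter F -> f @ F --> s -> sphere_loop (f x) @[x --> F] --> sphere_loop s.
Proof.
move=> FF fs; apply: cvgZ; last exact: cvg_collapse.
apply: cvgV; first by rewrite gt_eqF // gauge_gt0 // collapse_neq0.
by apply: cvg_gauge; exact: cvg_collapse.
Qed.

(** The point (1, 0) of R x R^7; [1 + 7] and [4 + 4] are convertible. *)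
Definition base_point : 'rV[R]_(4 + 4) := delta_mx ord0 (lshift 7 ord0 : 'I_(1 + 7)).

Lemma gauge_base_point : gauge base_point = 1.
Proof.
rewrite /gauge /qnorm !big_ord_recl !big_ord0 !mxE /=.
by rewrite !expr0n /= expr1n !addr0 sqrtr0 sqrtr1 max_l.
Qed.

Lemma sphere_loop_boundary s : cube_boundary s -> sphere_loop s = base_point.
Proof.
move=> /norm_center_boundary c1; suff cs : collapse s = base_point.
  by rewrite /sphere_loop cs gauge_base_point invr1 scale1r.
apply/rowP => k; case: (split_ordP (k : 'I_(1 + 7))) => l ->.
  by rewrite (ord1 l) collapse0 c1 mxE !eqxx /=; lra.
by rewrite collapseS c1 subrr mul0r mxE -val_eqE.
Qed.

(** Gauge 1 excludes the value 0, so [poincare_bohl] yields a boundary point where G s is a positive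
    multiple of 1 - 2 s. The prescribed values rule this out on every face. *)
Theorem sphere_loop_not_contractible (G : 'rV[R]_(1 + 7) -> 'rV[R]_(4 + 4)) :
  {within @cube R (1 + 7), continuous G} ->
  (forall s : 'rV[R]_(1 + 7), cube s -> gauge (G s) = 1) ->
  (forall s : 'rV[R]_(1 + 7), cube s -> s ord0 ord0 = 0 -> G s = sphere_loop (rsubmx s)) ->
  (forall s : 'rV[R]_(1 + 7), cube s -> s ord0 ord0 = 1 -> G s = base_point) ->
  (forall s : 'rV[R]_(1 + 7), cube s -> cube_boundary (rsubmx s) -> G s = base_point) ->
  False.
Proof.
move=> Gcont G1 Gbot Gtop Gside.
have [s cs||s [a [[cs [k sk]] a0 Gs]]] := @poincare_bohl R 7 G.
- exact: Gcont.
- move=> s cs; apply: contra_eq_neq (G1 s cs) => ->.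
  by rewrite -[0](scale0r base_point) gaugeZ // mul0r eq_sym oner_neq0.
pose t : 'rV[R]_7 := @rsubmx R 1 1 7 s.
have tS l : t ord0 l = s ord0 (rshift 1 l : 'I_(1 + 7)) by rewrite mxE.
have ct : cube t by move=> l; rewrite tS.
have e0 : (lshift 7 ord0 : 'I_(1 + 7)) = ord0 by apply/val_inj.
have G0 : G s ord0 (lshift 7 ord0 : 'I_(1 + 7)) = a * (1 - 2 * s ord0 ord0).
  by rewrite Gs e0.
have GS l : G s ord0 (rshift 1 l : 'I_(1 + 7)) = a * (1 - 2 * t ord0 l).
  by rewrite Gs tS.
move: sk; case: (split_ordP (k : 'I_(1 + 7))) => l ->.
- rewrite (ord1 l) e0 => -[s0|s1].
  (* Bottom: with y = [center t] and r = |y|, the first coordinate g (2 r - 1) = a > 0 excludes y =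
     0, but the others give g (1 - r) y = - a y, where 1 - r >= 0. *)
  + move: G0 GS; rewrite s0 (Gbot s) // -/t => G0 GS.
    set g := (gauge (collapse t))^-1; have g0 : 0 < g.
      by rewrite invr_gt0 gauge_gt0 // collapse_neq0.
    move: G0; rewrite mxE collapse0 -/g => G0.
    have r0 : center t != 0.
      by rewrite -normr_eq0; apply/eqP => r0; move: G0; rewrite r0; nra.
    have [i [j]] := mx_norm_attained r0; rewrite (ord1 i) => rj.
    have yj : center t ord0 j != 0 by rewrite -normr_eq0 -rj normr_eq0.
    have := GS j; rewrite mxE collapseS -/g => GSj.
    have : (g * (1 - `|center t|) + a) * center t ord0 j = 0.
      rewrite mulrDl -mulrA GSj [center t ord0 j]mxE; ring.
    move/eqP; rewrite mulf_eq0 (negPf yj) orbF => /eqP.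
    have : 0 <= g * (1 - `|center t|).
      by apply: mulr_ge0; [exact: ltW|rewrite subr_ge0; exact: norm_center_cube].
    lra.
  (* Top: the first coordinate is 1, but would have to be - a. *)
  + by move: G0; rewrite s1 (Gtop s) // mxE !eqxx /=; nra.
(* Sides: this coordinate of the base point is 0, but would have to be a or - a. *)
- move=> sl; have bt : cube_boundary t by split=> //; exists l; rewrite tS.
  have := GS l; rewrite (Gside s) // mxE -val_eqE /= tS.
  by case: sl => ->; nra.
Qed.

End SphereLoop.

(** * The 7-sphere as a retract of the moment-angle complex *)

Section MomentAngle.
Variables (R : realType) (m : nat) (K : simplicial_complex m) (i j : 'I_m).
Hypothesis ij : j != i.
Hypothesis Kij : [set i; j]%SET \notin simplices K.

(** The other coordinates are the quaternion 1, a point of S^3, so they need no vertex in the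
    simplex. *)
Definition pair_matrix (v : 'rV[R]_(4 + 4)) : 'M[R]_(m, 4) :=
  \matrix_(k, c) if k == i then lsubmx v ord0 c else
                 if k == j then rsubmx v ord0 c else (c == ord0)%:R.

Lemma row_pair_matrixl v : row i (pair_matrix v) = lsubmx v.
Proof. by apply/rowP => c; rewrite !mxE eqxx. Qed.

Lemma row_pair_matrixr v : row j (pair_matrix v) = rsubmx v.
Proof. by apply/rowP => c; rewrite !mxE (negPf ij) eqxx. Qed.

Lemma cvg_pair_matrix (T : Type) (F : set_system T) (f : T -> 'rV[R]_(4 + 4)) v :
  Filter F -> f @ F --> v -> pair_matrix (f x) @[x --> F] --> pair_matrix v.
Proof.
move=> FF fv; apply: cvg_mx => k c; rewrite !mxE; under eq_cvg do rewrite !mxE.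
case: ifP => _; first exact: cvg_coord.
case: ifP => _; [exact: cvg_coord|exact: cvg_cst].
Qed.

Lemma pair_matrix_moment_angle v :
  gauge v = 1 -> pair_matrix v \in @moment_angle_set R m K.
Proof.
move=> g1; rewrite inE.
(* The simplex is the vertex a, whose coordinate may be interior to the disk; coordinate b has norm
   1. *)
have vertex (a b : 'I_m) : qnorm (row b (pair_matrix v)) = 1 ->
    qnorm (row a (pair_matrix v)) <= 1 -> a != b ->
    ((a == i) && (b == j)) || ((a == j) && (b == i)) ->
    @moment_angle_set R m K (pair_matrix v).
  move=> qb qa anb ab; exists [set a]%SET; first exact: simplices_vertex.
  move=> k /=; rewrite finset.in_set1; case: eqP => [->//|/eqP ka].
  have [->//|kb] := eqVneq k b.
  have [ki kj] : k != i /\ k != j.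
    by case/orP: ab => /andP[/eqP <- /eqP <-].
  rewrite /sphere3 /= /qnorm (bigD1 ord0) //= !mxE (negPf ki) (negPf kj) eqxx.
  rewrite big1 => [|c /negPf c0]; last by rewrite !mxE (negPf ki) (negPf kj) c0 expr0n.
  by rewrite expr1n addr0 sqrtr1.
have hl : qnorm (row i (pair_matrix v)) <= 1 by rewrite row_pair_matrixl -g1 le_max lexx.
have hr : qnorm (row j (pair_matrix v)) <= 1 by rewrite row_pair_matrixr -g1 le_max lexx orbT.
have [lr|rl] := leP (qnorm (lsubmx v)) (qnorm (rsubmx v)).
  apply: (vertex i j); rewrite ?eqxx // 1?eq_sym //.
  by rewrite row_pair_matrixr -g1 /gauge max_r.
apply: (vertex j i); rewrite ?eqxx ?orbT //.
by rewrite row_pair_matrixl -g1 /gauge max_l // ltW.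
Qed.

Definition pair_point v (g1 : gauge v = 1) : moment_angle R K :=
  exist _ (pair_matrix v) (pair_matrix_moment_angle g1).

Definition pair_rows (z : moment_angle R K) : 'rV[R]_(4 + 4) :=
  row_mx (row i (set_val z)) (row j (set_val z)).

Lemma pair_rowsK v (g1 : gauge v = 1) : pair_rows (pair_point g1) = v.
Proof.
by rewrite /pair_rows set_valE /= row_pair_matrixl row_pair_matrixr hsubmxK.
Qed.

(* As {i, j} is not a simplex, one of the two coordinates is on the sphere. *)
Lemma gauge_pair_rows z : gauge (pair_rows z) = 1.
Proof.
rewrite /gauge row_mxKl row_mxKr.
case: z => z zP; rewrite set_valE /=; have [J KJ zJ] := set_mem zP.
have q1 k : qnorm (row k z) <= 1.
  by have := zJ k; case: ifP => // _ ->.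
have := zJ i; have := zJ j.
have [iJ|_] := boolP (i \in J); last by move=> _ /= e; rewrite max_l // e.
have [jJ|_] := boolP (j \in J); last by move=> /= e _; rewrite max_r // e.
move=> _ _; case/negP: Kij; apply: simplices_down KJ.
by apply/fintype.subsetP => k; rewrite !inE => /orP[] /eqP ->.
Qed.

Lemma cvg_pair_rows (T : Type) (F : set_system T) (f : T -> moment_angle R K) z :
  Filter F -> f @ F --> z -> pair_rows (f x) @[x --> F] --> pair_rows z.
Proof.
move=> FF fz.
have vz : set_val (f x) @[x --> F] --> set_val z.
  apply: (@continuous_cvg _ _ _ _ _ f set_val) => //; exact: initial_continuous.
apply: cvg_mx => k c; rewrite (ord1 k); case: (split_ordP c) => l ->.
  rewrite row_mxEl mxE; under eq_cvg do rewrite row_mxEl mxE; exact: cvg_coord.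
rewrite row_mxEr mxE; under eq_cvg do rewrite row_mxEr mxE; exact: cvg_coord.
Qed.

Definition moment_angle_loop (s : 'rV[R]_7) : moment_angle R K :=
  pair_point (gauge_sphere_loop s).

Lemma moment_angle_loop_continuous : continuous moment_angle_loop.
Proof.
apply: continuous_comp_initial => s.
suff : pair_matrix (sphere_loop t) @[t --> s] --> pair_matrix (sphere_loop s) by [].
apply: (@cvg_pair_matrix _ (nbhs s)); exact: (@cvg_sphere_loop _ _ (nbhs s) id).
Qed.

Lemma moment_angle_not_aspherical : ~ aspherical R (moment_angle R K).
Proof.
pose x := pair_point (gauge_base_point R).
move=> /(_ 7%N x isT) pi7.
have fl : nloop x moment_angle_loop.
  split; first by apply: continuous_subspaceT; exact: moment_angle_loop_continuous.
  move=> s bs; apply/val_inj; rewrite /= sphere_loop_boundary //.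
have cl : nloop x (fun _ : 'rV[R]_7 => x).
  by split => // s; exact: cst_continuous.
have := pi7 _ _ (ex_intro2 _ _ _ fl erefl) (ex_intro2 _ _ _ cl erefl).
(* The two classes are equal, and the constant loop lies in its own class, hence in that of
   [moment_angle_loop]. *)
move=> /(congr1 (fun C => C (fun=> x))) /= e.
have : nloop x (fun _ : 'rV[R]_7 => x) /\
    loop_homotopic x (fun _ : 'rV[R]_7 => x) (fun=> x).
  split=> //; exists (fun=> x); split=> // s; exact: cst_continuous.
rewrite -e => -[_ [H [Hcont H0 H1 Hb]]] {e pi7}.
(* The null-homotopy as a map on the 8-cube, with time as first coordinate, followed by the
   retraction. *)
pose G (s : 'rV[R]_(1 + 7)) := pair_rows (H (s ord0 ord0, rsubmx s)).
have cubeS (s : 'rV[R]_(1 + 7)) : cube s -> cube (rsubmx s) by move=> cs l; rewrite mxE.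
have cube_itv (s : 'rV[R]_(1 + 7)) : cube s -> `[0, 1]%classic (s ord0 ord0).
  by move=> cs; rewrite /= in_itv /=; exact: cs.
apply: (@sphere_loop_not_contractible R G).
- apply/subspace_continuousP => s cs; apply: cvg_pair_rows.
  move/subspace_continuousP: Hcont => /(_ (s ord0 ord0, rsubmx s)) Hs.
  have {}Hs := Hs (conj (cube_itv _ cs) (cubeS _ cs)).
  set W := within _ _; have idW : id @ W --> s by apply: cvg_within_filter; exact: cvg_id.
  have t0 : (fun t : 'rV[R]_(1 + 7) => t ord0 ord0) @ W --> s ord0 ord0.
    exact: (@cvg_coord _ _ _ _ W id).
  have tS : (fun t : 'rV[R]_(1 + 7) => rsubmx t) @ W --> rsubmx s.
    apply: cvg_mx => k c; rewrite mxE; under eq_cvg do rewrite mxE.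
    exact: (@cvg_coord _ _ _ _ W id).
  have tt := cvg_pair t0 tS.
  (* [H] is continuous only within its domain, so points of the 8-cube must be seen to land
     there. *)
  move=> U /Hs HU; have := tt _ _ _ _ HU; rewrite /= => /(_ _ _ _).
  apply: (@filterS _ (nbhs s)) => t tU ct; apply: tU => //.
  by split; [exact: cube_itv|exact: cubeS].
- by move=> s _; exact: gauge_pair_rows.
- by move=> s cs s0; rewrite /G s0 H0 ?pair_rowsK //; exact: cubeS.
- by move=> s cs s1; rewrite /G s1 H1 ?pair_rowsK //; exact: cubeS.
- move=> s cs bs; rewrite /G Hb ?pair_rowsK //; exact: cs.
Qed.

End MomentAngle.

Theorem lemma2p7 (R : realType) (m : nat) (K : simplicial_complex m)
  (hK : exists i : 'I_m, ~ conelike K i) :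
  ~ aspherical R (moment_angle R K).
Proof.
have [i /existsNP [j /not_implyP [ji /negP ijK]]] := hK.
exact: (moment_angle_not_aspherical ji ijK).
Qed.
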